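(* Let $(X, \tau)$ be a Lindelöf Hausdorff space. Then $t(X_\delta) \leq 2^{t(X)}$.
   Context: A space is Lindelöf if every open cover has a countable subcover (no regularity is assumed). $X_\delta$ denotes the set $X$ endowed with the $G_\delta$ topology, i.e. the topology generated by the $G_\delta$-subsets of $X$ (countable intersections of open subsets of $X$). For a space $Y$, the tightness $t(Y)$ is the least infinite cardinal $\kappa$ such that whenever $A \subset Y$ and $y \in \overline{A}$ there is $B \subset A$ with $|B| \leq \kappa$ and $y \in \overline{B}$. *)

(* Defs.v *)
From HB Require Import structures.
From mathcomp Require Import all_boot.
From mathcomp Require Import all_classical topology borel_hierarchy.

Set Implicit Arguments.
Unset Strict Implicit.
Unset Printing Implicit Defensive.

Local Open Scope classical_set_scope.
Local Open Scope card_scope.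

Definition lindelof_space (X : topologicalType) : Prop :=
  forall C : set (set X), C `<=` open -> \bigcup_(U in C) U = setT ->
  exists D : set (set X),
    [/\ D `<=` C, countable D & \bigcup_(U in D) U = setT].

(* The alias carries the topology generated by the Gdelta subsets of [X]. *)
Definition Gdelta_space (X : topologicalType) : Type := X.

HB.instance Definition _ (X : topologicalType) := Choice.on (Gdelta_space X).
HB.instance Definition _ (X : topologicalType) :=
  isSubBaseTopological.Build (Gdelta_space X) (@Gdelta X) id.

(* Cardinals are represented by sets, compared by [#<=]. *)
Definition tightness_bound (Y : topologicalType) (T : Type) (K : set T) : Prop :=
  forall (A : set Y) (y : Y), closure A y ->
  exists B : set Y, [/\ B `<=` A, B #<= K & closure B y].

Definition is_tightness (Y : topologicalType) (T : Type) (K : set T) : Prop :=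
  [/\ infinite_set K, tightness_bound Y K &
      forall (U : Type) (L : set U),
        infinite_set L -> tightness_bound Y L -> K #<= L].

(* As t(Y) is at most aleph_0 + |Y|, it has a representative among the subsets
   of [nat + Y]; [tightnessP] shows that the choice below succeeds. *)
Definition tightness (Y : topologicalType) : set (nat + Y) :=
  get [set K : set (nat + Y) | is_tightness Y K].
Arguments tightness : clear implicits.

Lemma card_le_least (I : Type) (T : I -> Type) (A : forall i, set (T i)) (i0 : I) :
  exists i, forall j, A i #<= A j.
Proof.
pose P (S : set (forall i, T i)) :=
  (forall f, S f -> forall i, A i (f i)) /\
  (forall i f g, S f -> S g -> f i = g i -> f = g).
have [F FP totF|S [[SA Sinj] Smax]] := @Zorn_bigcup _ P.
  split=> [f [S FS Sf] i|i f g [S FS Sf] [S' FS' S'g] fg].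
    by have [SA _] := FP _ FS; exact: SA.
  case: (totF _ _ FS FS') => sub.
    by have [_ inj] := FP _ FS'; apply: (inj i) => //; exact: sub.
  by have [_ inj] := FP _ FS; apply: (inj i) => //; exact: sub.
have [[i surj]|nsurj] :=
    pselect (exists i, A i `<=` (fun f : forall i, T i => f i) @` S).
  exists i => j.
  apply: (card_le_trans (subset_card_le surj)).
  apply: (card_le_trans (card_image_le _ _)).
  have : (fun f : forall i, T i => f j) @` S #= S.
    by apply: inj_card_eq => f g /set_mem Sf /set_mem Sg; exact: Sinj.
  rewrite card_eq_le => /andP[_ le].
  apply: (card_le_trans le); apply: subset_card_le.
  by move=> _ [f Sf <-]; exact: SA.
have ex i : exists a : T i, A i a /\ forall f, S f -> f i <> a.
  apply: contrapT => nex; apply: nsurj; exists i => a Aa.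
  apply: contrapT => nSa; apply: nex; exists a; split=> // f Sf fa.
  by apply: nSa; exists f.
pose h i := projT1 (cid (ex i)).
have Ah i : A i (h i) by have [] := projT2 (cid (ex i)).
have hS i f : S f -> f i <> h i.
  by have [_] := projT2 (cid (ex i)); exact.
exfalso; apply: (Smax (S `|` [set h])).
  split; first by left.
  by move=> /(_ h (or_intror erefl)) /(hS i0).
split=> [f [/SA //|->] //|i f g [Sf|->] [Sg|->] // fg].
- exact: Sinj fg.
- by case: (hS i f Sf).
- by case: (hS i g Sg).
Qed.

Lemma card_le_total (T U : Type) (A : set T) (B : set U) :
  A #<= B \/ B #<= A.
Proof.
pose V (b : bool) : Type := if b then T else U.
pose C (b : bool) : set (V b) :=
  match b return set (V b) with true => A | false => B end.
have [[] le] := card_le_least C true.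
- by left; exact: (le false).
- by right; exact: (le true).
Qed.

Lemma tightnessP (Y : topologicalType) : is_tightness Y (tightness Y).
Proof.
pose Z := (nat + Y)%type.
suff : exists K : set Z, is_tightness Y K by move/getPex.
pose P := [set L : set Z | infinite_set L /\ tightness_bound Y L].
have YZ (A : set Y) : A #<= [set: Z].
  have : (inr : Y -> Z) @` A #= A by apply: inj_card_eq => x y _ _ [].
  rewrite card_eq_le => /andP[_ le].
  exact: card_le_trans le (card_leT _).
have PT : P setT.
  split; last by move=> A y Ay; exists A; split; [|exact: YZ|].
  have : range (inl : nat -> Z) #= [set: nat].
    by apply: inj_card_eq => x y _ _ [].
  rewrite card_eq_le => /andP[_ le].
  by apply/infiniteP; exact: card_le_trans le (card_leT _).
have [[K [Kinf Kb]] Kle] :=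
  card_le_least (fun L : {L : set Z | P L} => projT1 L) (exist _ _ PT).
exists K; split=> //= U L Linf Lb.
have [LZ|ZL] := card_le_total L [set: Z]; last first.
  exact: card_le_trans (card_leT K) ZL.
have [L' LL'] : exists L' : set Z, L #= L'.
  have /card_leP[f] := LZ.
  exists (range (fun x : L => val (f x))).
  rewrite card_eq_sym; apply: card_eq_trans (card_setT L).
  by apply: inj_card_eq => x y xT yT /val_inj; exact: inj.
have PL' : P L'.
  move: LL'; rewrite card_eq_le => /andP[LL' _]; split.
    by apply/infiniteP; apply: card_le_trans LL'; apply/infiniteP.
  move=> A y /Lb[B [BA BL By]]; exists B; split=> //.
  exact: card_le_trans LL'.
apply: (card_le_trans (Kle (exist _ _ PL'))) => /=.
by move: LL'; rewrite card_eq_le => /andP[].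
Qed.

(* Main.v *)
Require Import Defs.
From mathcomp Require Import all_boot.
From mathcomp Require Import all_classical topology borel_hierarchy.

(** Write k for t(X), and let p be in the Gdelta-closure of A; a subset B of A
with at most 2^k points and p in its Gdelta-closure has to be found.

The separation step ([lindelof_hausdorff_separation]): a closed set Z that
misses p is Lindelof, and each of its points has an open neighbourhood whose
closure misses p, so countably many of these give an open set O containing Z
and a Gdelta set G containing p with O and G disjoint.  Fix such a pair
(O_D, G_D) for Z = closure D, for every D whose closure misses p.

The closing-off step ([small_closed_set]): p is in the Gdelta-closure of A, so
for every countable family of sets D_i the Gdelta set formed by the
intersection of the G_(D_i) meets A.  Let B be a nonempty subset of A that
contains a chosen point of this intersection for every countable family of
subsets D_i of B with at most k points.

This B works.  Let G be the intersection of open sets U_n, with p in G.  A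
point q of closure B outside U_n differs from p; by the Hausdorff property q
has a neighbourhood W whose closure misses p, and by tightness q is in the
closure of some D included in B and W with at most k points
([small_set_separation]).  So the sets O_D cover the closed, hence Lindelof,
set closure B minus U_n, and countably many of them suffice.  Doing so for all
n involves only countably many sets D in total; the point of B chosen for them
lies in all their G_D, hence in none of their O_D, hence in every U_n.

The choice function has k arguments, as a countable family of sets with at
most k points is a function on nat * nat * k.  The closure of a point under
such a function is the image of the well-founded k-branching trees, and a tree
is determined by its set of branches, finite words over k.  There are k finite
words ([card_seq]), hence at most 2^k points.  This avoids a transfinite
recursion of length k^+.  The bound on the number of words, which includes
k * k = k, is obtained from Zorn's lemma. *)

Set Implicit Arguments.
Unset Strict Implicit.
Unset Printing Implicit Defensive.

Local Open Scope classical_set_scope.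
Local Open Scope card_scope.

(** * Injections and powersets *)

Lemma card_leTP (T U : Type) :
  [set: T] #<= [set: U] <-> exists f : T -> U, injective f.
Proof.
split=> [/card_leP[f]|[f finj]].
  exists (fun x => val (f (to_setT x))) => x y /val_inj.
  by move=> /(inj (mem_set I) (mem_set I)) /(congr1 val).
have : f @` setT #= [set: T] by apply: inj_card_eq => x y _ _ /finj.
rewrite card_eq_le => /andP[_ le].
exact: card_le_trans le (card_leT _).
Qed.

Lemma card_le_selfmap (T : Type) (A B : set T) : A #<= B ->
  exists f : T -> T, (forall x, A x -> B (f x)) /\
    (forall x y, A x -> A y -> f x = f y -> x = y).
Proof.
elim/Ppointed: T => T in A B *; first by exists id; split=> x; case: (no x).
move=> /pcard_leP/injfunPex[f Af finj]; exists f; split=> // x y Ax Ay.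
by apply: finj; exact: mem_set.
Qed.

Lemma card_le_powerset (T U : Type) (K : set U) :
  [set: T] #<= K -> [set: set T] #<= [set S | S `<=` K].
Proof.
move=> TK; have /card_leTP[f finj] : [set: T] #<= [set: K].
  by apply: card_le_trans TK _; have := card_setT K; rewrite card_eq_le => /andP[].
pose g (S : set T) : set U := (fun x => val (f x)) @` S.
have ginj : injective g.
  have sub S S' : g S = g S' -> S `<=` S'.
    move=> e x Sx; have : g S (val (f x)) by exists x.
    by rewrite e => -[y S'y /val_inj/finj <-].
  by move=> S S' e; apply/seteqP; split; apply: sub.
have : g @` setT #= [set: set T] by apply: inj_card_eq => ? ? _ _ /ginj.
rewrite card_eq_le => /andP[_ le]; apply: card_le_trans le _.
apply: subset_card_le => _ [S _ <-] _ [x _ <-].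
exact: set_valP.
Qed.

(** * Finite words over an infinite set *)

(** For a coding [R] in the sense of [seq_coding], this is the alphabet whose
words [R] encodes; recording only [R], and reading the alphabet off its
one-letter words, lets Zorn's lemma order the codings by plain inclusion. *)
Definition coding_dom (K : choiceType) (R : set (seq K * K)) : set K :=
  [set x | exists y, R ([:: x], y)].

(** [R] is the graph of an injection of the nonempty words over an alphabet
into that alphabet.  Leaving out the empty word makes the empty relation a
coding, so that the union of an empty chain is covered too. *)
Definition seq_coding (K : choiceType) (R : set (seq K * K)) : Prop :=
  [/\ forall l x, R (l, x) ->
        [/\ l != [::], forall y, y \in l -> coding_dom R y & coding_dom R x],
      forall l, l != [::] -> (forall y, y \in l -> coding_dom R y) ->
        exists x, R (l, x),
      forall l x y, R (l, x) -> R (l, y) -> x = y &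
      forall l m x, R (l, x) -> R (m, x) -> l = m].

Lemma seq_coding_bigcup (K : choiceType) (F : set (set (seq K * K))) :
  F `<=` @seq_coding K -> total_on F subset ->
  seq_coding (\bigcup_(R in F) R).
Proof.
move=> FP totF.
have domS R : F R -> coding_dom R `<=` coding_dom (\bigcup_(R in F) R).
  by move=> FR x [y Rxy]; exists y, R.
have both R R' p q : F R -> F R' -> R p -> R' q ->
    exists S, [/\ F S, S p & S q].
  move=> FR FR' Rp R'q; case: (totF _ _ FR FR') => sub.
    by exists R'; split=> //; exact: sub.
  by exists R; split=> //; exact: sub.
split.
- move=> l x [R FR Rlx]; have [P1 _ _ _] := FP _ FR.
  have [l0 lR xR] := P1 _ _ Rlx; split=> //; last exact: domS xR.
  by move=> y /lR; exact: domS.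
- move=> l l0 ldom.
  suff [R FR lR] : exists2 R, F R & forall y, y \in l -> coding_dom R y.
    have [_ P2 _ _] := FP _ FR; have [x Rlx] := P2 _ l0 lR.
    by exists x, R.
  elim: l l0 ldom => // a l IH _ ldom.
  have [b [R FR Rab]] := ldom a (mem_head _ _).
  have [->|l0] := eqVneq l [::].
    by exists R => // y; rewrite inE => /eqP->; exists b.
  have [|R' FR' lR'] := IH l0; first by move=> y yl; apply: ldom; rewrite inE yl orbT.
  case: (totF _ _ FR FR') => sub.
    exists R' => // y; rewrite inE => /predU1P[->|/lR' //].
    by exists b; exact: sub.
  exists R => // y; rewrite inE => /predU1P[->|/lR' [z R'yz]]; first by exists b.
  by exists z; exact: sub.
- move=> l x y [R FR Rlx] [R' FR' R'ly].
  have [S [FS Sx Sy]] := both _ _ _ _ FR FR' Rlx R'ly.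
  by have [_ _ P3 _] := FP _ FS; exact: P3 Sx Sy.
- move=> l m x [R FR Rlx] [R' FR' R'ly].
  have [S [FS Sx Sy]] := both _ _ _ _ FR FR' Rlx R'ly.
  by have [_ _ _ P4] := FP _ FS; exact: P4 Sx Sy.
Qed.

(** The words over a countable alphabet are countable: the relation codes the
word [map f m] by [f (pickle m)], for an injection [f] of [nat] into [K]. *)
Lemma seq_coding_nat (K : choiceType) : infinite_set [set: K] ->
  exists R : set (seq K * K), seq_coding R /\ coding_dom R !=set0.
Proof.
move=> /infiniteP/card_leTP[f finj].
pose R : set (seq K * K) :=
  [set p | exists2 m : seq nat, m != [::] & p = (map f m, f (pickle m))].
have domR x : coding_dom R x <-> exists n, x = f n.
  split=> [[y [[|a [|b m]] //= _ [-> _]]]|[n ->]]; first by exists a.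
  by exists (f (pickle [:: n])), [:: n].
exists R; split; last by exists (f 0); apply/domR; exists 0.
split.
- move=> l x [m m0 [-> ->]]; split.
  + by case: m m0.
  + by move=> y /mapP[n _ ->]; apply/domR; exists n.
  + by apply/domR; exists (pickle m).
- move=> l l0 ldom.
  suff [m lm] : exists m, l = map f m.
    exists (f (pickle m)), m; last by rewrite lm.
    by apply: contra_neq l0 => m0; rewrite lm m0.
  elim: l {l0} ldom => [|a l IH] ldom; first by exists [::].
  have /domR[n an] := ldom a (mem_head _ _).
  have [|m ->] := IH; first by move=> y yl; apply: ldom; rewrite inE yl orbT.
  by exists (n :: m); rewrite an.
- by move=> l x y [m _ [-> ->]] [m' _ [/(inj_map finj) -> ->]].
- move=> l l' x [m _ [-> ->]] [m' _ [-> /finj]].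
  by move=> /(pcan_inj pickleK) ->.
Qed.

Lemma seq_coding_fun (K : choiceType) (x0 : K) (R : set (seq K * K)) :
  seq_coding R -> exists f : seq K -> K,
    [/\ forall l, l != [::] -> (forall y, y \in l -> coding_dom R y) ->
          R (l, f l),
        forall l, l != [::] -> (forall y, y \in l -> coding_dom R y) ->
          coding_dom R (f l) &
        forall l m, l != [::] -> m != [::] ->
          (forall y, y \in l -> coding_dom R y) ->
          (forall y, y \in m -> coding_dom R y) -> f l = f m -> l = m].
Proof.
move=> [P1 P2 P3 P4].
pose f l := xget x0 [set x | R (l, x)].
have fR l : l != [::] -> (forall y, y \in l -> coding_dom R y) -> R (l, f l).
  by move=> l0 /(P2 _ l0); exact: (@xgetPex _ x0 [set x | R (l, x)]).
exists f; split=> // [l l0 lR|l m l0 m0 lR mR e].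
  by have [_ _] := P1 _ _ (fR _ l0 lR).
by apply: (P4 _ _ (f l)); [|rewrite e]; exact: fR.
Qed.


Lemma maximal_seq_coding (K : choiceType) : infinite_set [set: K] ->
  exists R : set (seq K * K), [/\ seq_coding R, coding_dom R !=set0 &
    forall R', R `<` R' -> ~ seq_coding R'].
Proof.
move=> Kinf; have [R [PR Rmax]] := Zorn_bigcup (@seq_coding_bigcup K).
exists R; split=> //; apply: contrapT => domR0.
have R0 p : ~ R p.
  case: p => l x Rlx; have [P1 _ _ _] := PR.
  by apply: domR0; exists x; have [] := P1 _ _ Rlx.
have [R' [PR' [x [y R'xy]]]] := seq_coding_nat Kinf.
apply: (Rmax R') => //; split=> [p /R0 //|sub].
exact: R0 (sub _ R'xy).
Qed.

(** If [B] is no larger than the alphabet [S] of a coding, so is their union: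
a letter of [S] is sent to the code of a word of length 1, a point of [B] to
the code of a word of length 2. *)
Lemma seq_coding_absorb (K : choiceType) (R : set (seq K * K)) (B : set K) :
  seq_coding R -> coding_dom R !=set0 -> B #<= coding_dom R ->
  exists h : K -> K,
    (forall x, coding_dom R x \/ B x -> coding_dom R (h x)) /\
    (forall x y, coding_dom R x \/ B x -> coding_dom R y \/ B y ->
       h x = h y -> x = y).
Proof.
move=> PR [x0 _] BR; set S := coding_dom R in BR *.
have [g [gS ginj]] := card_le_selfmap BR.
have [f [_ fS finj]] := seq_coding_fun x0 PR.
pose code x := if x \in S then [:: x] else [:: g x; g x].
have code0 x : code x != [::] by rewrite /code; case: ifP.
have codeS x : S x \/ B x -> forall y, y \in code x -> S y.
  rewrite /code; case: ifPn => [/set_mem Sx _ y|].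
    by rewrite inE => /eqP->.
  move=> /negP nSx [Sx|Bx] y; first by case: nSx; exact: mem_set.
  by rewrite !inE orbb => /eqP->; exact: gS.
exists (f \o code); split=> [x Hx|x y Hx Hy /=]; first exact/fS/codeS.
move/(finj _ _ (code0 x) (code0 y) (codeS _ Hx) (codeS _ Hy)).
rewrite /code; case: ifPn => xS; case: ifPn => yS // [] //.
move/negP: xS => nxS; move/negP: yS => nyS e _.
case: Hx => [/mem_set //|Bx]; case: Hy => [/mem_set //|By].
exact: ginj e.
Qed.

(** When there is room for a copy [T] of the alphabet [S] outside of [S], the
coding extends to [S] and [T] together: the words over the union inject into
[S] by absorption, and the new ones among them get their codes in [T], away
from the old codes. *)
Lemma seq_coding_extend (K : choiceType) (R : set (seq K * K)) :
  seq_coding R -> coding_dom R !=set0 -> coding_dom R #<= ~` coding_dom R ->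
  exists R', R `<` R' /\ seq_coding R'.
Proof.
move=> PR R0; have [x0 Sx0] := R0.
set S := coding_dom R => le.
have [g [gT ginj]] := card_le_selfmap le.
have [f [fR fS finj]] := seq_coding_fun x0 PR.
pose T := g @` S.
have TS x : T x -> ~ S x by move=> [y Sy <-]; exact: gT.
have [h [hS hinj]] := seq_coding_absorb PR R0 (card_image_le g S).
have [P1 P2 P3 P4] := PR.
pose new l := [/\ l != [::], forall y, y \in l -> S y \/ T y &
                 ~ forall y, y \in l -> S y].
pose R' := R `|` [set p | new p.1 /\ p.2 = g (f (map h p.1))].
have maph l : new l -> map h l != [::] /\ forall y, y \in map h l -> S y.
  move=> [l0 lST _]; split; first by case: l l0 {lST}.
  by move=> _ /mapP[y yl ->]; apply: hS; exact: lST.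
have domR' x : coding_dom R' x <-> S x \/ T x.
  split=> [[y [Rxy|[[_ /= + _] _]]]|].
  - by left; exists y.
  - by apply; rewrite mem_head.
  have [Sx _|nSx] := pselect (S x); first by have [y Rxy] := Sx; exists y; left.
  move=> [//|Tx]; exists (g (f (map h [:: x]))); right; split=> //; split=> //.
    by move=> y; rewrite inE => /eqP->; right.
  by move=> /(_ x (mem_head _ _)).
have newT l x : new l -> x = g (f (map h l)) -> T x.
  by move=> /maph[m0 mS] ->; exists (f (map h l)) => //; exact: fS.
exists R'; split.
  split=> [p|sub]; first by left.
  have Tx : T (g x0) by exists x0.
  have /domR'[y] : S (g x0) \/ T (g x0) by right.
  by move=> /sub Rxy; apply: (TS _ Tx); exists y.
split.
- move=> l x [Rlx|[/= nl xE]].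
    have [l0 lR xR] := P1 _ _ Rlx.
    by split=> // [y yl|]; apply/domR'; left; [exact: lR|].
  have [l0 lST _] := nl; split=> // [y yl|]; apply/domR'; first exact: lST.
  by right; exact: newT xE.
- move=> l l0 ldom.
  have [lS|nlS] := pselect (forall y, y \in l -> S y).
    by exists (f l); left; exact: fR.
  exists (g (f (map h l))); right; split=> //; split=> //.
  by move=> y yl; apply/domR'; exact: ldom.
- move=> l x y [Rlx|[/= nl ->]] [Rly|[/= nl' ->]] //.
  + exact: P3 Rlx Rly.
  + by case: nl' => _ _ []; have [] := P1 _ _ Rlx.
  + by case: nl => _ _ []; have [] := P1 _ _ Rly.
- move=> l m x [Rlx|[/= nl xE]] [Rmx|[/= nm xE']].
  + exact: P4 Rlx Rmx.
  + by case: (TS x); [exact: newT xE'|have [] := P1 _ _ Rlx].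
  + by case: (TS x); [exact: newT xE|have [] := P1 _ _ Rmx].
  + have [l0 lS] := maph _ nl; have [m0 mS] := maph _ nm.
    move: xE'; rewrite xE => /(ginj _ _ (fS _ l0 lS) (fS _ m0 mS)).
    move=> /(finj _ _ l0 m0 lS mS); case: nl nm => _ lST _ [_ mST _].
    elim: l m {l0 lS m0 mS xE} lST mST => [|a l IH] [|b m] //= lST mST [e].
    move=> /IH-> //; last 2 first.
    * by move=> y yl; apply: lST; rewrite inE yl orbT.
    * by move=> y ym; apply: mST; rewrite inE ym orbT.
    by congr cons; apply: hinj e; [apply: lST|apply: mST]; rewrite mem_head.
Qed.

(** The alphabet of a maximal coding cannot be extended, so its complement is
no larger than the alphabet, which therefore absorbs all of [K]. *)
Lemma card_seq (K : choiceType) :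
  infinite_set [set: K] -> [set: seq K] #<= [set: K].
Proof.
move=> Kinf; have [R [PR R0 Rmax]] := maximal_seq_coding Kinf.
have [/(seq_coding_extend PR R0)[R' [RR' /Rmax]] //|le] :=
  card_le_total (coding_dom R) (~` coding_dom R).
have [h [hS hinj]] := seq_coding_absorb PR R0 le.
have ST x : coding_dom R x \/ (~` coding_dom R) x by exact: EM.
have {}hinj : injective h by move=> x y; exact: hinj.
have [x0 _] := R0.
have [f [_ _ finj]] := seq_coding_fun x0 PR.
(* The extra letter [x0] makes the empty word nonempty. *)
apply/card_leTP; exists (fun l => f (map h (x0 :: l))) => l m.
have hl l' y : y \in map h l' -> coding_dom R y.
  by move=> /mapP[z _ ->]; exact: hS.
move=> /(finj (map h (x0 :: l)) (map h (x0 :: m)) isT isT (hl _) (hl _)).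
by move=> /(inj_map hinj) [].
Qed.

(** Each triple is spelled as three letters, natural numbers being embedded in
the infinite set [K]. *)
Lemma card_seq_nat2_prod (T : choiceType) (K : set T) : infinite_set K ->
  [set: seq (nat * nat * K)] #<= K.
Proof.
move=> Kinf; have := card_setT K; rewrite card_eq_le => /andP[leK leT].
have KinfT : infinite_set [set: K].
  by apply/infiniteP; apply: card_le_trans leT; apply/infiniteP.
apply: card_le_trans leK; apply: card_le_trans (card_seq KinfT).
have /infiniteP/card_leTP[c cinj] := KinfT; apply/card_leTP.
exists (fun s => flatten [seq [:: c x.1.1; c x.1.2; x.2] | x <- s]).
elim=> [|[[n m] k] s IH] [|[[n' m'] k'] s'] //=.
by move=> [/cinj-> /cinj-> -> /IH->].
Qed.

(** * Closing off under an operation of infinite arity *)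

Inductive tree (I : Type) : Type :=
| Leaf : tree I
| Node : (I -> tree I) -> tree I.
Arguments Leaf {I}.

(** The words that lead from the root to an inner node; they determine the
tree, as a leaf has none and an inner node has the empty word. *)
Fixpoint branches (I : Type) (t : tree I) : set (seq I) :=
  match t with
  | Leaf => set0
  | Node s => fun l => if l is i :: l' then branches (s i) l' else True
  end.

Lemma branches_inj (I : Type) : injective (@branches I).
Proof.
elim=> [|s IH] [|s'] //= e.
- by have : set0 (Nil I) by rewrite e.
- by have : set0 (Nil I) by rewrite -e.
congr Node; apply/funext => i; apply: IH; apply/funext => l.
exact: (congr1 (@^~ (i :: l)) e).
Qed.

(** The closure of [y0] under [F] consists of the values of the terms built
from [y0] and [F], and these terms are the [I]-branching trees. *)
Lemma small_closed_set (I Y : Type) (y0 : Y) (F : (I -> Y) -> Y) :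
  exists B : set Y, [/\ B y0, forall f, (forall i, B (f i)) -> B (F f),
    B `<=` [set y0] `|` range F & B #<= [set: set (seq I)]].
Proof.
pose eval := fix eval (t : tree I) : Y :=
  match t with Leaf => y0 | Node s => F (fun i => eval (s i)) end.
exists (range eval); split.
- by exists Leaf.
- move=> f Bf.
  have /choice[s sE] : forall i, exists t, eval t = f i.
    by move=> i; have [t _ <-] := Bf i; exists t.
  by exists (Node s) => //=; congr F; apply/funext.
- move=> _ [[|s] _ <-] /=; first by left.
  by right; exists (fun i => eval (s i)).
- apply: card_le_trans (card_image_le _ _) _.
  by apply/card_leTP; exists (@branches I); exact: branches_inj.
Qed.

(** * Lindelof spaces and the Gdelta topology *)

Lemma lindelof_closed (X : topologicalType) (Z : set X) (C : set (set X)) :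
  lindelof_space X -> closed Z -> C !=set0 -> C `<=` open ->
  Z `<=` \bigcup_(U in C) U ->
  exists W : nat -> set X, (forall n, C (W n)) /\ Z `<=` \bigcup_n W n.
Proof.
move=> hL Zcl [U0 CU0] Copen ZC.
have [||D [DC Dcount DT]] := hL (C `|` [set ~` Z]).
- by move=> U [/Copen //|->]; exact: closed_openC.
- apply/seteqP; split=> // x _; have [/ZC[U CU Ux]|nZx] := pselect (Z x).
    by exists U => //; left.
  by exists (~` Z) => //; right.
have DCsub : D `&` C `<=` D by move=> U [].
have := card_le_trans (subset_card_le DCsub) Dcount.
move=> /pfcard_geP[DC0|[W]].
  exists (fun=> U0); split=> // x Zx.
  have : (\bigcup_(U in D) U) x by rewrite DT.
  move=> [U DU Ux]; have [CU|UZ] := DC _ DU; last by move: Ux; rewrite UZ.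
  by have : (D `&` C) U; [|rewrite DC0].
exists W; split=> [n|x Zx]; first by have [] := 'funS_W (I : setT n).
have : (\bigcup_(U in D) U) x by rewrite DT.
move=> [U DU Ux]; have [CU|UZ] := DC _ DU; last by move: Ux; rewrite UZ.
have [n _ Wn] : (W @` setT) U by apply: 'surj_W.
by exists n => //; rewrite Wn.
Qed.

Lemma Gdelta_bigcap (X : topologicalType) (J : countType) (V : J -> set X) :
  (forall i, Gdelta (V i)) -> Gdelta (\bigcap_i V i).
Proof.
move=> VG; have /choice[W WP] : forall i, exists W : nat -> set X,
    (forall n, open (W n)) /\ V i = \bigcap_n W n.
  by move=> i; have [W Wo ->] := VG i; exists W.
exists (fun c => if unpickle c is Some (i, n) then W i n else setT).
  move=> c; case: unpickle => [[i n]|]; last exact: openT.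
  by have [+ _] := WP i; exact.
apply/seteqP; split=> x xV; first move=> c _.
  case: unpickle => [[i n]|] //.
  by have := xV i I; have [_ ->] := WP i; exact.
move=> i _; have [_ ->] := WP i => n _.
by have := xV (pickle (i, n)) I; rewrite pickleK.
Qed.

Lemma Gdelta_bigcap_seq (X : topologicalType) (s : seq (set X)) :
  (forall S, S \in s -> Gdelta S) -> Gdelta (\bigcap_(S in [set` s]) S).
Proof.
move=> sG.
have -> : \bigcap_(S in [set` s]) S = \bigcap_(i : nat) nth setT s i.
  apply/seteqP; split=> x sx.
    move=> i _; have [si|si] := ltnP i (size s); last by rewrite nth_default.
    by apply: sx; exact: mem_nth.
  by move=> S Ss; have := sx (index S s) I; rewrite nth_index.
apply: Gdelta_bigcap => i; have [si|si] := ltnP i (size s).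
  by apply: sG; exact: mem_nth.
by rewrite nth_default //; apply: open_Gdelta; exact: openT.
Qed.

(** The Gdelta sets are a base of the topology that they generate, because a
finite intersection of Gdelta sets is a Gdelta set. *)
Lemma closure_GdeltaP (X : topologicalType) (A : set X) (p : X) :
  closure (A : set (Gdelta_space X)) p <->
  forall G : set X, Gdelta G -> G p -> A `&` G !=set0.
Proof.
split=> [Ap G GG Gp|AG N].
  apply: Ap; rewrite nbhsE; exists G => //; split=> //.
  exists [set G]; last by rewrite bigcup_set1.
  by move=> _ ->; exact: (@finI_from1 _ _ _ id).
rewrite nbhsE => -[_ [[E EI <-] [H EH Hp]] EN].
have [D DG HE] : finI_from (@Gdelta X) id H := EI _ EH.
have HG : Gdelta (H : set X).
  rewrite -HE; apply: (@Gdelta_bigcap_seq _ (finmap.enum_fset D)) => S SD.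
  exact/set_mem/DG.
have [x [Ax Hx]] := AG _ HG Hp; exists x; split=> //; apply: EN.
by exists H.
Qed.

(** * Tightness of the Gdelta topology *)

(** Every point of [Z] is in an open set [W] disjoint from an open
neighbourhood [V] of [p].  Countably many of the sets [W] cover [Z]; their
union is [O], and the intersection of the corresponding [V] is [G]. *)
Lemma lindelof_hausdorff_separation (X : topologicalType) (Z : set X) (p : X) :
  lindelof_space X -> hausdorff_space X -> closed Z -> ~ Z p ->
  exists O G : set X, [/\ open O, Z `<=` O, Gdelta G, G p & O `&` G = set0].
Proof.
rewrite open_hausdorff => hL hH Zcl nZp.
pose C := [set W : set X | open W /\
  exists V, [/\ open V, V p & W `&` V = set0]].
have [|||W [CW ZW]] := @lindelof_closed _ Z C hL Zcl.
- exists set0; split; first exact: open0.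
  by exists setT; split; [exact: openT| |rewrite set0I].
- by move=> W [].
- move=> x Zx; have /hH[[W V] [/set_mem Wx /set_mem Vp] [oW oV /eqP WV]] : x != p.
    by apply: contra_notN nZp => /eqP<-.
  by exists W => //; split=> //; exists V.
have /choice[V VP] n := (CW n).2.
exists (\bigcup_n W n), (\bigcap_n V n); split=> //.
- by apply: bigcup_open => n _; have [] := CW n.
- by exists V => // n; have [] := VP n.
- by move=> n _; have [] := VP n.
apply/seteqP; split=> // x [[n _ Wx] Vx].
by have [_ _ <-] := VP n; split=> //; exact: Vx.
Qed.

(** For disjoint open neighbourhoods [W] of [q] and [V] of [p], the point [q] is
in the closure of the intersection of [A] and [W]; a small subset of it that
still has [q] in its closure stays away from [V].  The subset is given as a
family indexed by [K], possibly with repetitions, which is the form used by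
[small_closed_set]. *)
Lemma small_set_separation (X : topologicalType) (T : Type) (K : set T)
    (A : set X) (p q : X) :
  hausdorff_space X -> tightness_bound X K -> closure A q -> q != p ->
  exists g : K -> X, [/\ forall k, A (g k), closure (range g) q &
    ~ closure (range g) p].
Proof.
move=> hH tK clAq qp; move: hH; rewrite open_hausdorff => /(_ _ _ qp).
move=> [[W V] [/set_mem Wq /set_mem Vp] [oW oV /eqP WV]].
have [N Nq|D [DAW DK clDq]] := tK (A `&` W) q.
  have [|x [Ax [Nx Wx]]] := clAq (N `&` W); last by exists x.
  by apply: filterI => //; exact: open_nbhs_nbhs.
have [D0|/surjfunPex[g Dg]] : D = set0 \/ $|{surjfun [set: K] >-> D}|.
- apply/pfcard_geP; apply: card_le_trans DK _.
  by have := card_setT K; rewrite card_eq_le => /andP[].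
- by have [x []] := clDq setT filterT; rewrite D0.
exists g; rewrite -Dg; split=> // [k|clDp].
  by have [] : (A `&` W) (g k) by apply: DAW; rewrite Dg; exists k.
have [x [/DAW[_ Wx] Vx]] := clDp V (open_nbhs_nbhs (conj oV Vp)).
by rewrite -[False]/(set0 x) -WV.
Qed.

(** The closing-off argument, stated in terms of the Gdelta sets of [X] so that
[X] carries a single topology. *)
Lemma small_Gdelta_dense (X : topologicalType) (T : choiceType) (K : set T)
    (A : set X) (p : X) :
  lindelof_space X -> hausdorff_space X -> infinite_set K ->
  tightness_bound X K ->
  (forall G, Gdelta G -> G p -> A `&` G !=set0) ->
  exists B : set X, [/\ B `<=` A, B #<= [set S | S `<=` K] &
    forall G, Gdelta G -> G p -> B `&` G !=set0].
Proof.
move=> hL hH Kinf tK clAp.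
have [a0 [Aa0 _]] : A `&` setT !=set0.
  by apply: clAp => //; apply: open_Gdelta; exact: openT.
(* If [closure D] contains [p] there is nothing to separate, and the pair
   (set0, setT) keeps the other requirements true. *)
have /choice[OG OGP] : forall D : set X, exists OG : set X * set X,
    [/\ open OG.1, ~ closure D p -> closure D `<=` OG.1,
        Gdelta OG.2, OG.2 p & OG.1 `&` OG.2 = set0].
  move=> D; have [Dp|nDp] := pselect (closure D p).
    exists (set0, setT); split=> //=; first exact: open0.
    + by apply: open_Gdelta; exact: openT.
    + by rewrite set0I.
  have [O [G [? ? ? ? ?]]] :=
    lindelof_hausdorff_separation hL hH (@closed_closure _ D) nDp.
  by exists (O, G).
(* [f] codes the countable family of the sets [piece f nm]. *)
pose piece (f : nat * nat * K -> X) (nm : nat * nat) : set X :=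
  range (fun k => f (nm, k)).
have /choice[F FP] : forall f, exists a, A a /\ forall nm, (OG (piece f nm)).2 a.
  move=> f; have [||a [Aa Ga]] := clAp (\bigcap_nm (OG (piece f nm)).2).
  - by apply: Gdelta_bigcap => nm; have [] := OGP (piece f nm).
  - by move=> nm _; have [] := OGP (piece f nm).
  - by exists a; split=> // nm; exact: Ga.
have [B [Ba0 BF BA Bcard]] := small_closed_set a0 F.
exists B; split.
- by move=> b /BA[->|[f _ <-]] //; have [] := FP f.
- apply: card_le_trans Bcard _; apply: card_le_powerset.
  exact: card_seq_nat2_prod.
move=> _ [U Uopen ->] Up.
have CUn n : exists g : nat -> K -> X, (forall m k, B (g m k)) /\
    closure B `&` ~` U n `<=` \bigcup_m (OG (range (g m))).1.
  pose C := [set O | exists2 g : K -> X, forall k, B (g k) &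
                                         (OG (range g)).1 = O].
  have [||||W [CW ZW]] :=
    @lindelof_closed _ (closure B `&` ~` U n) C hL.
  - by apply: closedI; [exact: closed_closure|exact: open_closedC].
  - by exists (OG (range (fun _ : K => a0))).1, (fun=> a0).
  - by move=> _ [g _ <-]; have [] := OGP (range g).
  - move=> q [clBq nUq].
    have [|g [gB clq clp]] := @small_set_separation _ _ _ _ p _ hH tK clBq.
      by apply: contra_notN nUq => /eqP->; exact: Up.
    exists (OG (range g)).1; first by exists g.
    by have [_ + _ _ _] := OGP (range g); exact.
  have /choice[g gP] : forall m, exists g : K -> X,
      (forall k, B (g k)) /\ (OG (range g)).1 = W m.
    by move=> m; have [g] := CW m; exists g.
  exists g; split=> [m|x /ZW[m _ Wx]]; first by have [] := gP m.
  by exists m => //; have [_ ->] := gP m.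
have /choice[g gP] := CUn.
pose f (i : nat * nat * K) := g i.1.1 i.1.2 i.2.
have Bb : B (F f) by apply: BF => i; have [+ _] := gP i.1.1; exact.
have [_ Gb] := FP f.
exists (F f); split=> // n _; apply: contrapT => nUb.
have [_ /(_ (F f))[|m _ Ob]] := gP n.
  by split=> //; exact: subset_closure.
have [_ _ _ _ disj] := OGP (piece f (n, m)).
by rewrite -[False]/(set0 (F f)) -disj; split=> //; exact: Gb.
Qed.

Lemma tightness_bound_Gdelta (X : topologicalType) (T : choiceType) (K : set T) :
  lindelof_space X -> hausdorff_space X -> infinite_set K ->
  tightness_bound X K ->
  tightness_bound (Gdelta_space X) [set S | S `<=` K].
Proof.
move=> hL hH Kinf tK A p /closure_GdeltaP clAp.
have [B [BA Bcard clBp]] := small_Gdelta_dense hL hH Kinf tK clAp.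
by exists B; split=> //; exact/closure_GdeltaP.
Qed.

Theorem theorem9 (X : topologicalType) (hL : lindelof_space X)
    (hH : hausdorff_space X) :
  tightness (Gdelta_space X) #<= [set S | S `<=` tightness X].
Proof.
have [Kinf Kb _] := tightnessP X.
have [_ _] := tightnessP (Gdelta_space X); apply; last first.
  exact: tightness_bound_Gdelta.
(* Singletons embed [nat] into its powerset, hence into that of the tightness. *)
apply/infiniteP; apply: card_le_trans (card_le_powerset (iffLR (infiniteP _) Kinf)).
apply/card_leTP; exists set1 => m n mn.
by have : [set n] m by rewrite -mn.
Qed.
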